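(* Let $\mathcal{R}$ be a commutative ring, $\mathbf{M}$ an $\mathcal{R}$-module, $a,b,c,d\in\mathcal{R}$, and let $(x_{n,k})_{n,k\ge0}$ be a double Fibonacci sequence in $\mathbf{M}$ of type $(a,b)\otimes(c,d)$. Then its generating function $G(t,s)=\sum_{n,k\ge0}x_{n,k}t^ns^k$ is rational and is given by $$G(t,s)=q(t)^{-1}r(s)^{-1}\big[x_{0,0}(1-at)(1-cs)+x_{1,0}\,t(1-cs)+x_{0,1}(1-at)s+x_{1,1}\,ts\big],$$ where $q(t)=1-at-bt^{2}$ and $r(s)=1-cs-ds^{2}$.
   Context: A double sequence $(x_{n,k})_{n,k\ge0}$ with $x_{n,k}\in\mathbf{M}$ is a double Fibonacci sequence of type $(a,b)\otimes(c,d)$ if for all $n,k\ge0$ $$x_{n+2,k}=a x_{n+1,k}+b x_{n,k},\qquad x_{n,k+2}=c x_{n,k+1}+d x_{n,k}.$$ The generating function is an element of $\mathbf{M}[[t,s]]$, the module of formal power series with coefficients in $\mathbf{M}$, viewed as a module over $\mathcal{R}[[t,s]]$; the inverses $q(t)^{-1}$, $r(s)^{-1}$ are taken in $\mathcal{R}[[t,s]]$. *)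

(* Defs.v *)
From HB Require Import structures.
From mathcomp Require Import all_boot all_order all_algebra.
From mathcomp Require Import boolp.

Set Implicit Arguments.
Unset Strict Implicit.
Unset Printing Implicit Defensive.

Import GRing.Theory.
Local Open Scope ring_scope.

(* [fps2 V] is V[[t,s]]; [coef2 f n k] is the coefficient of t^n s^k. *)
Record fps2 (V : Type) : Type := Fps2 { coef2 : nat -> nat -> V }.

Lemma fps2P (V : Type) (f g : fps2 V) :
  (forall n k, coef2 f n k = coef2 g n k) -> f = g.
Proof.
case: f g => [f] [g] /= fg; congr Fps2.
by apply/funext => n; apply/funext => k.
Qed.

HB.instance Definition _ (V : Type) := gen_eqMixin (fps2 V).
HB.instance Definition _ (V : Type) := gen_choiceMixin (fps2 V).

Section Additive.
Variable V : zmodType.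
Implicit Types f g h : fps2 V.

Definition fps2_zero : fps2 V := Fps2 (fun _ _ => 0).
Definition fps2_opp f : fps2 V := Fps2 (fun n k => - coef2 f n k).
Definition fps2_add f g : fps2 V := Fps2 (fun n k => coef2 f n k + coef2 g n k).

Fact fps2_addA : associative fps2_add.
Proof. by move=> f g h; apply: fps2P => n k /=; rewrite addrA. Qed.
Fact fps2_addC : commutative fps2_add.
Proof. by move=> f g; apply: fps2P => n k /=; rewrite addrC. Qed.
Fact fps2_add0 : left_id fps2_zero fps2_add.
Proof. by move=> f; apply: fps2P => n k /=; rewrite add0r. Qed.
Fact fps2_addN : left_inverse fps2_zero fps2_opp fps2_add.
Proof. by move=> f; apply: fps2P => n k /=; rewrite addNr. Qed.

HB.instance Definition _ := GRing.isZmodule.Build (fps2 V)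
  fps2_addA fps2_addC fps2_add0 fps2_addN.

Definition fps2C (v : V) : fps2 V :=
  Fps2 (fun n k => if (n == 0%N) && (k == 0%N) then v else 0).

End Additive.

Lemma sum_triangle (V : zmodType) (n : nat) (F : nat -> nat -> nat -> V) :
  \sum_(i < n.+1) \sum_(j < (n - i).+1) F i j (n - i - j)%N =
  \sum_(i < n.+1) \sum_(j < i.+1) F j (i - j)%N (n - i)%N.
Proof.
elim: n F => [|n IHn] F; first by rewrite !big_ord1.
rewrite big_ord_recl subn0.
under [RHS]eq_bigr => i _ do rewrite big_ord_recl subn0.
rewrite [RHS]big_split /=; congr (_ + _).
rewrite [RHS]big_ord_recl big_ord0 add0r.
exact: (IHn (fun i j l => F i.+1 j l)).
Qed.

Section Scale.
Variables (R : comPzRingType) (V : lmodType R).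
Implicit Types (f g : fps2 R) (h : fps2 V).

Definition fps2_scale f h : fps2 V := Fps2 (fun n k =>
  \sum_(i < n.+1) \sum_(j < k.+1) coef2 f i j *: coef2 h (n - i) (k - j)).

Fact fps2_scale1 h : fps2_scale (fps2C 1) h = h.
Proof.
apply: fps2P => n k /=.
rewrite big_ord_recl [X in _ + X]big1 ?addr0; last first.
  by move=> i _; apply: big1 => j _; rewrite scale0r.
rewrite big_ord_recl big1 ?addr0 ?subn0 ?scale1r //.
by move=> j _; rewrite scale0r.
Qed.

Fact fps2_scaleDr f : {morph fps2_scale f : h1 h2 / h1 + h2}.
Proof.
move=> h1 h2; apply: fps2P => n k /=.
rewrite -big_split; apply: eq_bigr => i _ /=.
by rewrite -big_split; apply: eq_bigr => j _ /=; rewrite scalerDr.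
Qed.

Fact fps2_scaleDl h : {morph fps2_scale^~ h : f g / f + g}.
Proof.
move=> f g; apply: fps2P => n k /=.
rewrite -big_split; apply: eq_bigr => i _ /=.
by rewrite -big_split; apply: eq_bigr => j _ /=; rewrite scalerDl.
Qed.

End Scale.

Section Ring.
Variable R : comPzRingType.
Implicit Types f g : fps2 R.

Definition fps2_mul f g : fps2 R := Fps2 (fun n k =>
  \sum_(i < n.+1) \sum_(j < k.+1) coef2 f i j * coef2 g (n - i) (k - j)).

Lemma fps2_scaleA (V : lmodType R) f g (h : fps2 V) :
  fps2_scale f (fps2_scale g h) = fps2_scale (fps2_mul f g) h.
Proof.
apply: fps2P => n k /=.
transitivity (\sum_(i < n.+1) \sum_(i' < (n - i).+1)
    \sum_(j < k.+1) \sum_(j' < (k - j).+1)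
      (coef2 f i j * coef2 g i' j') *: coef2 h (n - i - i') (k - j - j')).
  apply: eq_bigr => i _; rewrite exchange_big /=; apply: eq_bigr => j _.
  rewrite scaler_sumr; apply: eq_bigr => i' _.
  by rewrite scaler_sumr; apply: eq_bigr => j' _; rewrite scalerA.
rewrite (sum_triangle n (fun i i' l => \sum_(j < k.+1) \sum_(j' < (k - j).+1)
      (coef2 f i j * coef2 g i' j') *: coef2 h l (k - j - j')%N)).
apply: eq_bigr => i _ /=.
under eq_bigr => i' _ do rewrite (sum_triangle k (fun j j' l =>
      (coef2 f i' j * coef2 g (i - i')%N j') *: coef2 h (n - i)%N l)).
rewrite exchange_big /=; apply: eq_bigr => j _.
rewrite scaler_suml; apply: eq_bigr => i' _.
by rewrite scaler_suml.
Qed.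

Fact fps2_mulA : associative fps2_mul.
Proof. by move=> f g h; apply: (@fps2_scaleA R^o f g h). Qed.

Fact fps2_mulC : commutative fps2_mul.
Proof.
move=> f g; apply: fps2P => n k /=.
rewrite (reindex_inj rev_ord_inj) /=; apply: eq_bigr => i _.
rewrite (reindex_inj rev_ord_inj) /=; apply: eq_bigr => j _.
by rewrite !subSS !subKn -1?ltnS // mulrC.
Qed.

Fact fps2_mul1 : left_id (fps2C 1) fps2_mul.
Proof. exact: (@fps2_scale1 R R^o). Qed.

Fact fps2_mulDl : left_distributive fps2_mul +%R.
Proof. move=> f g h; exact: (@fps2_scaleDl R R^o h f g). Qed.

HB.instance Definition _ := GRing.Zmodule_isComPzRing.Build (fps2 R)
  fps2_mulA fps2_mulC fps2_mul1 fps2_mulDl.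

HB.instance Definition _ (V : lmodType R) :=
  GRing.Zmodule_isLmodule.Build (fps2 R) (fps2 V)
    (@fps2_scaleA V) (@fps2_scale1 R V) (@fps2_scaleDr R V) (@fps2_scaleDl R V).

Definition fps2_t : fps2 R :=
  Fps2 (fun n k => if (n == 1%N) && (k == 0%N) then 1 else 0).
Definition fps2_s : fps2 R :=
  Fps2 (fun n k => if (n == 0%N) && (k == 1%N) then 1 else 0).

End Ring.

(* [GRing.unit] and [GRing.inv] require a nontrivial ring; the zero ring is
   allowed here. *)
Definition invertible (A : comPzRingType) (u : A) : Prop :=
  exists v : A, v * u = 1.

(* The inverse of [u]; the junk value [u] if [u] is not invertible. *)
Definition inverse (A : comPzRingType) (u : A) : A :=
  if pselect (invertible u) is left uP then projT1 (cid uP) else u.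

Lemma inverseV (A : comPzRingType) (u : A) :
  invertible u -> inverse u * u = 1.
Proof. by rewrite /inverse; case: pselect => // uP _; case: cid. Qed.

Definition is_poly2 (V : zmodType) (f : fps2 V) : Prop :=
  exists N : nat, forall n k, (N <= n)%N || (N <= k)%N -> coef2 f n k = 0.

(* A series in M[[t,s]] is rational if it is D^-1 P with P in M[t,s] and D in
   R[t,s] invertible in R[[t,s]]. *)
Definition rational2 (R : comPzRingType) (M : lmodType R) (f : fps2 M) : Prop :=
  exists (D : fps2 R) (P : fps2 M),
    [/\ is_poly2 D, invertible D, is_poly2 P & f = inverse D *: P].

Definition double_fibonacci (R : comPzRingType) (M : lmodType R)
    (a b c d : R) (x : nat -> nat -> M) : Prop :=
  forall n k : nat,
    x n.+2 k = a *: x n.+1 k + b *: x n k /\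
    x n k.+2 = c *: x n k.+1 + d *: x n k.

Definition generating_function (V : Type) (x : nat -> nat -> V) : fps2 V :=
  Fps2 x.

(* Main.v *)
(** Multiplication by [q(t)] applies the recurrence in [n] to the rows of [G],
   so [q G = (1 - a t) G_0(s) + t G_1(s)], where [G_m] is the generating function
   of [k |-> x m k]. Each [G_m] satisfies the recurrence in [k], so likewise
   [r G_m = (1 - c s) x m 0 + s x m 1]. Hence [(q r) G] is the claimed numerator.
   The first identity, for the solution of the recurrence in [R] with initial
   values [1, a], also produces the inverse of [q]. *)
Require Import Defs.
From HB Require Import structures.
From mathcomp Require Import all_boot all_order all_algebra.

Set Implicit Arguments.
Unset Strict Implicit.
Unset Printing Implicit Defensive.

Import GRing.Theory.
Local Open Scope ring_scope.

Lemma coef2D (V : zmodType) (f g : fps2 V) n k :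
  coef2 (f + g) n k = coef2 f n k + coef2 g n k.
Proof. by []. Qed.

Lemma coef2N (V : zmodType) (f : fps2 V) n k :
  coef2 (- f) n k = - coef2 f n k.
Proof. by []. Qed.

Section Coefficients.
Variables (R : comPzRingType) (V : lmodType R).
Implicit Types (f g : fps2 V) (p : fps2 R) (v : V) (n k : nat).

Lemma coef2Z p f n k : coef2 (p *: f) n k =
  \sum_(i < n.+1) \sum_(j < k.+1) coef2 p i j *: coef2 f (n - i) (k - j).
Proof. by []. Qed.

(** At most one term of the convolution survives. The monomial is given by its coefficients so that
    [fps2C c], [t] and [s] are instances by mere computation. *)
Lemma coef2_monomZ (p : fps2 R) (c : R) i0 j0 f n k :
  (forall i j, coef2 p i j = if (i == i0) && (j == j0) then c else 0) ->
  coef2 (p *: f) n k =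
  if (i0 <= n)%N && (j0 <= k)%N then c *: coef2 f (n - i0) (k - j0) else 0.
Proof.
move=> pE; rewrite coef2Z pair_big /=.
under eq_bigr => ij _ do rewrite pE.
case: ifP => [/andP[i0n j0k]|nle].
- pose i : 'I_n.+1 := Ordinal (i0n : (i0 < n.+1)%N).
  pose j : 'I_k.+1 := Ordinal (j0k : (j0 < k.+1)%N).
  rewrite (bigD1 (i, j)) //= !eqxx big1 ?addr0 // => -[i' j'] /= ne.
  case: ifP => [/andP[/eqP ii /eqP jj]|_]; last by rewrite scale0r.
  by move/eqP: ne; case; congr pair; apply: val_inj.
(* Here [(i0, j0)] lies outside the range of summation. *)
apply: big1 => -[i j] _ /=; case: ifP => [/andP[/eqP ii /eqP jj]|_].
  by move: nle; rewrite -ii -jj !leq_ord.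
by rewrite scale0r.
Qed.

Lemma coef2_CZ (c : R) f n k : coef2 (fps2C c *: f) n k = c *: coef2 f n k.
Proof. by rewrite (@coef2_monomZ _ c 0 0) // !subn0. Qed.

Lemma coef2_tZ0 f k : coef2 (fps2_t R *: f) 0 k = 0.
Proof. exact: (@coef2_monomZ _ 1 1 0). Qed.

Lemma coef2_tZS f n k : coef2 (fps2_t R *: f) n.+1 k = coef2 f n k.
Proof. by rewrite (@coef2_monomZ _ 1 1 0) // subn0 scale1r subn1. Qed.

Lemma coef2_sZ0 f n : coef2 (fps2_s R *: f) n 0 = 0.
Proof. by rewrite (@coef2_monomZ _ 1 0 1) // andbF. Qed.

Lemma coef2_sZS f n k : coef2 (fps2_s R *: f) n k.+1 = coef2 f n k.
Proof. by rewrite (@coef2_monomZ _ 1 0 1) // subn0 scale1r subn1. Qed.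

End Coefficients.

(** Constant in [t]: this embeds the series in [s] alone, such as [G_m(s)]. *)
Definition constt (V : zmodType) (u : nat -> V) : fps2 V :=
  Fps2 (fun n k => if n is 0 then u k else 0).

Definition consts (V : zmodType) (u : nat -> V) : fps2 V :=
  Fps2 (fun n k => if k is 0 then u n else 0).

Section Recurrences.
Variables (R : comPzRingType) (V : lmodType R) (a b : R).
Implicit Types (x : nat -> nat -> V) (u : nat -> V).
Local Notation t := (fps2_t R).
Local Notation s := (fps2_s R).

(** From [t^2] on, the recurrence cancels every coefficient. Row 0 is [x 0], and row 1 is
    [x 1 - a x 0], whose second term comes from the factor [1 - a t]. *)
Lemma recurrence_t x :
  (forall n k, x n.+2 k = a *: x n.+1 k + b *: x n k) ->
  (1 - fps2C a * t - fps2C b * t ^+ 2) *: Fps2 x =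
  (1 - fps2C a * t) *: constt (x 0%N) + t *: constt (x 1%N).
Proof.
move=> xE; apply: fps2P => n k.
rewrite !scalerBl !scale1r expr2 -!scalerA.
case: n => [|[|n]]; rewrite !(coef2D, coef2N, coef2_CZ).
- by rewrite !coef2_tZ0 /= !scaler0 !subr0 addr0.
- by rewrite !(coef2_tZ0, coef2_tZS) /= scaler0 subr0 sub0r addrC.
by rewrite !coef2_tZS /= xE -addrA -opprD subrr scaler0 subrr addr0.
Qed.

Lemma recurrence_s x :
  (forall n k, x n k.+2 = a *: x n k.+1 + b *: x n k) ->
  (1 - fps2C a * s - fps2C b * s ^+ 2) *: Fps2 x =
  (1 - fps2C a * s) *: consts (x^~ 0%N) + s *: consts (x^~ 1%N).
Proof.
move=> xE; apply: fps2P => n k.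
rewrite !scalerBl !scale1r expr2 -!scalerA.
case: k => [|[|k]]; rewrite !(coef2D, coef2N, coef2_CZ).
- by rewrite !coef2_sZ0 /= !scaler0 !subr0 addr0.
- by rewrite !(coef2_sZ0, coef2_sZS) /= scaler0 subr0 sub0r addrC.
by rewrite !coef2_sZS /= xE -addrA -opprD subrr scaler0 subrr addr0.
Qed.

(** The double array of [constt u] has row [u] followed by zero rows, so all its rows satisfy the
    recurrence in [k]; its columns 0 and 1 have a single entry each, hence the constants on the
    right. *)
Lemma recurrence_constt u :
  (forall k, u k.+2 = a *: u k.+1 + b *: u k) ->
  (1 - fps2C a * s - fps2C b * s ^+ 2) *: constt u =
  (1 - fps2C a * s) *: fps2C (u 0%N) + s *: fps2C (u 1%N).
Proof.
move=> uE; rewrite recurrence_s => [|[|n] k]; last 2 first.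
- exact: uE.
- by rewrite !scaler0 addr0.
by congr (_ *: _ + _ *: _); apply: fps2P => -[|n] [|k].
Qed.

Lemma recurrence_consts u :
  (forall n, u n.+2 = a *: u n.+1 + b *: u n) ->
  (1 - fps2C a * t - fps2C b * t ^+ 2) *: consts u =
  (1 - fps2C a * t) *: fps2C (u 0%N) + t *: fps2C (u 1%N).
Proof.
move=> uE; rewrite recurrence_t => [|n [|k]]; last 2 first.
- exact: uE.
- by rewrite !scaler0 addr0.
by congr (_ *: _ + _ *: _); apply: fps2P => -[|n] [|k].
Qed.

End Recurrences.

Section Inverses.
Variables (R : comPzRingType) (a b : R).

(** Two consecutive terms are carried along to make the two-step recurrence structural. *)
Fixpoint fib_pair (n : nat) : R * R :=
  if n is n'.+1 then
    let: (u, v) := fib_pair n' in (v, a * v + b * u)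
  else (1, a).

Definition fib (n : nat) : R := (fib_pair n).1.

Lemma fibSS n : fib n.+2 = a * fib n.+1 + b * fib n.
Proof. by rewrite /fib /=; case: (fib_pair n). Qed.

Lemma invertible_t :
  invertible (1 - fps2C a * fps2_t R - fps2C b * fps2_t R ^+ 2).
Proof.
exists (consts fib); rewrite mulrC.
apply: (etrans (@recurrence_consts R R^o a b fib fibSS)).
(* Scaling in [R^o] is ring multiplication; the initial values 1 and [a] are chosen so that this
   numerator collapses to 1. *)
change ((1 - fps2C a * fps2_t R) * 1 + fps2_t R * fps2C a = 1).
by rewrite mulr1 [fps2_t R * _]mulrC subrK.
Qed.

Lemma invertible_s :
  invertible (1 - fps2C a * fps2_s R - fps2C b * fps2_s R ^+ 2).
Proof.
exists (constt fib); rewrite mulrC.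
apply: (etrans (@recurrence_constt R R^o a b fib fibSS)).
change ((1 - fps2C a * fps2_s R) * 1 + fps2_s R * fps2C a = 1).
by rewrite mulr1 [fps2_s R * _]mulrC subrK.
Qed.

End Inverses.

Lemma invertibleM (A : comPzRingType) (u v : A) :
  invertible u -> invertible v -> invertible (u * v).
Proof.
by move=> [u' uK] [v' vK]; exists (u' * v'); rewrite mulrACA uK vK mulr1.
Qed.

Section Polynomials.
Variables (R : comPzRingType) (V : lmodType R).

Lemma is_poly2_monom (U : zmodType) (f : fps2 U) (c : U) i0 j0 :
  (forall i j, coef2 f i j = if (i == i0) && (j == j0) then c else 0) ->
  is_poly2 f.
Proof.
move=> fE; exists (maxn i0 j0).+1 => n k le; rewrite fE.
case: ifP => // /andP[/eqP nE /eqP kE]; move: le.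
by rewrite nE kE !gtn_max !ltnn andbF.
Qed.

Lemma is_poly2C (U : zmodType) (v : U) : is_poly2 (fps2C v).
Proof. exact: (@is_poly2_monom _ _ v 0 0). Qed.

Lemma is_poly2t : is_poly2 (fps2_t R).
Proof. exact: (@is_poly2_monom _ _ 1 1 0). Qed.

Lemma is_poly2s : is_poly2 (fps2_s R).
Proof. exact: (@is_poly2_monom _ _ 1 0 1). Qed.

Lemma is_poly2D (U : zmodType) (f g : fps2 U) :
  is_poly2 f -> is_poly2 g -> is_poly2 (f + g).
Proof.
move=> [N fN] [N' gN]; exists (maxn N N') => n k le.
rewrite coef2D fN ?gN ?addr0 //.
all: by move: le; rewrite !geq_max => /orP[] /andP[N0 N1]; apply/orP; auto.
Qed.

Lemma is_poly2N (U : zmodType) (f : fps2 U) : is_poly2 f -> is_poly2 (- f).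
Proof.
by move=> [N fN]; exists N => n k /fN f0; rewrite coef2N f0 oppr0.
Qed.

Lemma is_poly2Z (p : fps2 R) (f : fps2 V) :
  is_poly2 p -> is_poly2 f -> is_poly2 (p *: f).
Proof.
(* If the factor from [p] can be nonzero, then [i] and [j] are below [N], so one of [n - i], [k - j]
   is still at least [N']. *)
move=> [N pN] [N' fN]; exists (N + N')%N => n k le.
rewrite coef2Z; apply: big1 => i _; apply: big1 => j _.
case: (boolP ((N <= i) || (N <= j))%N) => [/pN->|]; first by rewrite scale0r.
rewrite negb_or -!ltnNge => /andP[iN jN]; rewrite fN ?scaler0 //.
case/orP: le => le; apply/orP; [left | right].
- by have := leq_sub le (ltnW iN); rewrite addKn.
by have := leq_sub le (ltnW jN); rewrite addKn.
Qed.

End Polynomials.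

Lemma is_poly2M (R : comPzRingType) (f g : fps2 R) :
  is_poly2 f -> is_poly2 g -> is_poly2 (f * g).
Proof. exact: (@is_poly2Z R R^o). Qed.

Theorem proposition1p9 (R : comPzRingType) (M : lmodType R) (a b c d : R)
    (x : nat -> nat -> M) (hx : double_fibonacci a b c d x) :
  let t : fps2 R := fps2_t R in
  let s : fps2 R := fps2_s R in
  let q : fps2 R := 1 - fps2C a * t - fps2C b * t ^+ 2 in
  let r : fps2 R := 1 - fps2C c * s - fps2C d * s ^+ 2 in
  let G : fps2 M := generating_function x in
  [/\ invertible q, invertible r, rational2 G &
      G = (inverse q * inverse r) *:
        (((1 - fps2C a * t) * (1 - fps2C c * s)) *: fps2C (x 0%N 0%N)
         + (t * (1 - fps2C c * s)) *: fps2C (x 1%N 0%N)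
         + ((1 - fps2C a * t) * s) *: fps2C (x 0%N 1%N)
         + (t * s) *: fps2C (x 1%N 1%N))].
Proof.
move=> t s q r G; set P := (X in _ *: X).
have qU : invertible q by exact: invertible_t.
have rU : invertible r by exact: invertible_s.
have GP : (q * r) *: G = P.
  rewrite mulrC -scalerA /G /generating_function /q.
  rewrite recurrence_t; last by move=> n k; exact: (hx n k).1.
  (* [r] is moved past [1 - a t] and [t] to act directly on the two row series. *)
  rewrite scalerDr !scalerA ![r * _]mulrC -!scalerA /r.
  rewrite !recurrence_constt; try by move=> k; exact: (hx _ k).2.
  by rewrite !scalerDr !scalerA addrACA addrA.
have polyC1 : is_poly2 (1 : fps2 R) by exact: is_poly2C.
have polyt := is_poly2t R; have polys := is_poly2s R.
have polyl (e : R) (z : fps2 R) : is_poly2 z -> is_poly2 (1 - fps2C e * z).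
  by move=> zP; apply: is_poly2D => //; apply/is_poly2N/is_poly2M/zP/is_poly2C.
have polyq (e f : R) (z : fps2 R) :
    is_poly2 z -> is_poly2 (1 - fps2C e * z - fps2C f * z ^+ 2).
  move=> zP; apply: is_poly2D; first exact: polyl.
  by apply/is_poly2N/is_poly2M; [exact: is_poly2C | exact: is_poly2M].
split=> //.
(* [inverse (q * r)] is never compared with [inverse q * inverse r]: by [GP], each cancels against
   [q * r] on its own. *)
- exists (q * r), P; split.
  + by apply: is_poly2M; apply: polyq.
  + exact: invertibleM.
  + by do ?apply: is_poly2D; apply: is_poly2Z (is_poly2C _);
      apply: is_poly2M => //; apply: polyl.
  + by rewrite -GP scalerA inverseV ?scale1r //; apply: invertibleM.
- by rewrite -GP scalerA mulrACA !inverseV // mulr1 scale1r.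
Qed.
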